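(* Let $G$ and $H$ be nontrivial, connected graphs such that $G \times H$ is well-covered but not very well-covered. Then every edge of $G$ is incident with a triangle, i.e., for every edge $xy$ of $G$, at least one of $x$, $y$ lies on a triangle of $G$.
   Context: All graphs are finite and simple; nontrivial means having at least two vertices. The direct product $G\times H$ has vertex set $V(G)\times V(H)$, with $(g_1,h_1)(g_2,h_2)$ an edge iff $g_1g_2\in E(G)$ and $h_1h_2\in E(H)$. A graph is well-covered if all of its maximal independent sets have the same cardinality. A graph is very well-covered if it is well-covered, has no isolated vertices, and its independence number equals half its order. *)

(* Defs.v *)
From mathcomp Require Import all_boot.

Set Implicit Arguments.
Unset Strict Implicit.
Unset Printing Implicit Defensive.

Record sgraph := SGraph {
  vertex :> finType;
  edge : rel vertex;
  edge_sym : symmetric edge;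
  edge_irrefl : irreflexive edge
}.

Section DirectProduct.
Variables G H : sgraph.

Definition dprod_edge : rel (G * H) :=
  fun u v => edge u.1 v.1 && edge u.2 v.2.

Lemma dprod_edge_sym : symmetric dprod_edge.
Proof. by move=> u v; rewrite /dprod_edge (edge_sym u.1) (edge_sym u.2). Qed.

Lemma dprod_edge_irrefl : irreflexive dprod_edge.
Proof. by move=> u; rewrite /dprod_edge edge_irrefl. Qed.

Definition direct_product : sgraph := SGraph dprod_edge_sym dprod_edge_irrefl.
End DirectProduct.

Section GraphNotions.
Variable G : sgraph.

Definition nontrivial : Prop := 1 < #|G|.

Definition connected : Prop := forall x y : G, connect (@edge G) x y.

Definition independent (S : {set G}) : bool :=
  [forall x in S, forall y in S, ~~ edge x y].

Definition independence_number : nat :=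
  \max_(S : {set G} | independent S) #|S|.

Definition well_covered : Prop :=
  forall A B : {set G},
    maxset independent A -> maxset independent B -> #|A| = #|B|.

Definition no_isolated_vertex : Prop := forall x : G, exists y : G, edge x y.

Definition very_well_covered : Prop :=
  [/\ well_covered, no_isolated_vertex & 2 * independence_number = #|G|].

(* The three vertices are automatically distinct since edge is irreflexive. *)
Definition on_triangle (x : G) : Prop :=
  exists y z : G, [/\ edge x y, edge y z & edge z x].
End GraphNotions.

(* Main.v *)
Require Import Defs.
From mathcomp Require Import all_boot zify.

Set Implicit Arguments.
Unset Strict Implicit.
Unset Printing Implicit Defensive.

(** For B independent in G, let N(B) be its neighbourhood and
    cl(B) = {z | N(z) is included in N(B)}.  If A is a maximal independent set
    of H, then the set of pairs (g, h) with g outside N(B) when h is in A, and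
    g in cl(B) when h is not in A, is a maximal independent set of G x H.
    Comparing it with its instance B = 0, namely G x A, yields
    |A| |N(B)| = (|H| - |A|) |cl(B)|.

    Suppose that neither end of the edge xy lies on a triangle: N(x) and N(y)
    are independent.  Let B be maximal among the independent sets
    avoiding N(x) and N(y), and put X = N(x) \ N(B), Y = N(y) \ N(B), so that
    V(G) is the union of B, N(B), X and Y.  Then B, B + X and B + Y are
    independent and equal to their closures, and their neighbourhoods are N(B),
    N(B) + Y and N(B) + X.  The three equations give
    |A| |Y| = (|H| - |A|) |X| and |A| |X| = (|H| - |A|) |Y|; as y is in X, this
    forces 2 |A| = |H|, which makes G x H very well-covered. *)

(** * Neighbourhoods, closures and maximal independent sets *)

Section Independence.
Variable G : sgraph.
Implicit Types (B S W : {set G}) (v x y z : G).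

Definition nbhd x : {set G} := [set v | edge x v].

Definition nbhds B : {set G} := [set v | [exists u in B, edge u v]].

Definition closure_set B : {set G} := [set z | nbhd z \subset nbhds B].

Lemma independentP S :
  reflect {in S &, forall x y, ~~ edge x y} (independent S).
Proof.
apply: (iffP forall_inP) => [indS x y xS yS | indS x xS].
  by have /forall_inP/(_ y yS) := indS x xS.
by apply/forall_inP => y yS; apply: indS.
Qed.

Lemma independent_set0 : independent (@set0 G).
Proof. by apply/independentP => x y; rewrite inE. Qed.

Lemma nbhdsP B v : reflect (exists2 u, u \in B & edge u v) (v \in nbhds B).
Proof. by rewrite inE; apply: exists_inP. Qed.

Lemma closure_setP B z :
  reflect (forall v, edge z v -> v \in nbhds B) (z \in closure_set B).
Proof.
rewrite inE; apply: (iffP subsetP) => sub v.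
  by move=> zv; apply: sub; rewrite inE.
by rewrite inE; apply: sub.
Qed.

Lemma nbhdsS B S : B \subset S -> nbhds B \subset nbhds S.
Proof.
move=> /subsetP BS; apply/subsetP => v /nbhdsP[u uB uv].
by apply/nbhdsP; exists u => //; apply: BS.
Qed.

Lemma sub_closure_set B : B \subset closure_set B.
Proof.
by apply/subsetP => b bB; apply/closure_setP => v bv; apply/nbhdsP; exists b.
Qed.

Lemma independent_nbhds B v : independent B -> v \in B -> v \notin nbhds B.
Proof.
move=> /independentP indB vB; apply/nbhdsP => -[u uB].
by apply/negP/indB.
Qed.

(** If [z] and [w] in the closure were adjacent, [w] would have a neighbour [b] in [B]; then [b], a
    neighbour of [w], would lie in [nbhds B], against independence. *)
Lemma independent_closure_set B : independent B -> independent (closure_set B).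
Proof.
move=> indB; apply/independentP => z w zc /closure_setP wc; apply/negP => zw.
have /closure_setP/(_ _ zw)/nbhdsP[b bB bw] := zc.
have := wc b; rewrite edge_sym => /(_ bw).
exact/negP/independent_nbhds.
Qed.

Lemma closure_set_nbhds B z :
  independent B -> z \in closure_set B -> z \notin nbhds B.
Proof.
move=> indB zC; apply/nbhdsP => -[b bB].
apply/negP; apply: (independentP _ (independent_closure_set indB)) => //.
exact: (subsetP (sub_closure_set B)).
Qed.

Lemma independentU1 v S :
  independent S -> v \notin nbhds S -> independent (v |: S).
Proof.
move=> /independentP indS /nbhdsP vS; apply/independentP => p q.
rewrite !inE => /predU1P[->|pS] /predU1P[->|qS].
- by rewrite edge_irrefl.
- by apply/negP => vq; apply: vS; exists q; rewrite // edge_sym.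
- by apply/negP => pv; apply: vS; exists p.
- exact: indS.
Qed.

(** Serves twice: it provides [A] in the whole of [H], and [B] in the part of [G] outside two
    neighbourhoods. *)
Lemma maximal_independent_in W :
  exists2 B, independent B /\ B \subset W & W \subset B :|: nbhds B.
Proof.
pose P B := independent B && (B \subset W).
have P0 : P set0 by rewrite /P independent_set0 sub0set.
have [B /maxsetP[/andP[indB BW] maxB] _] := maxset_exists P0.
exists B => //; apply/subsetP => v vW; rewrite inE orbC -implyNb.
apply/implyP => vB; rewrite -(maxB (v |: B)) ?subsetUr ?setU11 //.
by rewrite /P independentU1 // subUset sub1set vW.
Qed.

Lemma maxset_independent S :
  independent S -> setT \subset S :|: nbhds S -> maxset (@independent G) S.
Proof.
move=> indS /subsetP domS; apply/maxsetP; split=> // T indT ST.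
apply/eqP; rewrite eqEsubset ST andbT; apply/subsetP => v vT.
have := domS v (in_setT v); rewrite inE => /orP[//|vS].
have := independent_nbhds indT vT.
by rewrite (subsetP (nbhdsS ST)).
Qed.

Lemma well_covered_independence_number S :
  well_covered G -> maxset (@independent G) S -> independence_number G = #|S|.
Proof.
move=> wcG maxS; apply/eqP; rewrite eqn_leq; apply/andP; split; last first.
  exact: (leq_bigmax_cond _ (maxsetp maxS)).
apply/bigmax_leqP => T /maxset_exists[T' maxT' /subset_leq_card TT'].
by rewrite (wcG _ _ maxS maxT').
Qed.

Lemma connected_no_isolated_vertex :
  nontrivial G -> connected G -> no_isolated_vertex G.
Proof.
move=> /card_gt1P[u [v [_ _ uv]]] connG x.
have [w wx] : exists w, w != x.
  by case: (eqVneq u x) uv => [->|ux _]; [exists v; rewrite eq_sym | exists u].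
have /connectP[[|z p] /=] := connG x w; last by case/andP=> xz _ _; exists z.
by move=> _ wE; rewrite wE eqxx in wx.
Qed.

Lemma triangle_free_nbhd x : ~ on_triangle x -> independent (nbhd x).
Proof.
move=> ntx; apply/independentP => u v; rewrite !inE => xu xv.
apply/negP => uv; apply: ntx; exists u, v; split=> //.
by rewrite edge_sym.
Qed.

End Independence.

Arguments nbhd {G}.
Arguments nbhds {G}.
Arguments closure_set {G}.

(** * Maximal independent sets of the product and their sizes *)

Section WellCoveredProduct.
Variables G H : sgraph.
Hypothesis niG : no_isolated_vertex G.
Hypothesis niH : no_isolated_vertex H.
Variable A : {set H}.
Hypothesis indA : independent A.
Hypothesis domA : setT \subset A :|: nbhds A.

Definition twisted (B : {set G}) : {set direct_product G H} :=
  setX (~: nbhds B) A :|: setX (closure_set B) (~: A).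

Lemma card_twisted B :
  #|twisted B| =
  (#|G| - #|nbhds B|) * #|A| + #|closure_set B| * (#|H| - #|A|).
Proof.
rewrite cardsU !cardsX (cardsCs (~: nbhds B)) (cardsCs (~: A)) !setCK.
rewrite [X in _ - X](_ : _ = 0) ?subn0 //.
by apply/eqP; rewrite cards_eq0; apply/eqP/setP => -[g h]; rewrite !inE /=;
   case: (h \in A); rewrite ?andbF.
Qed.

Lemma maxset_twisted B :
  independent B -> maxset (@independent (direct_product G H)) (twisted B).
Proof.
move=> indB; apply: maxset_independent.
  apply/independentP => -[g h] [g' h']; rewrite !in_setU !in_setX !in_setC.
  move=> gh gh'; apply/negP => /andP[/= gg' hh'].
  case: (boolP (h \in A)) gh => hA; case: (boolP (h' \in A)) gh' => h'A /=;
    rewrite ?andbF ?andbT ?orbF => g'B gB.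
  - by have /negP[] := independentP _ indA _ _ hA h'A.
  - move/closure_setP: g'B => /(_ g); rewrite edge_sym => /(_ gg').
    exact/negP.
  - by have /closure_setP/(_ _ gg') := gB; apply/negP.
  - have /independentP indC := independent_closure_set indB.
    by have /negP[] := indC _ _ gB g'B.
apply/subsetP => -[g h] _; rewrite inE.
case: (boolP (_ \in twisted B)) => //=.
rewrite !in_setU !in_setX !in_setC negb_or.
case: (boolP (h \in A)) => hA; rewrite /= !(andbT, andbF) /=.
  (* Over [A]: every neighbour [h'] of [h] is outside [A], so [(b, h')] is in the set. *)
  rewrite negbK => /nbhdsP[b bB bg].
  have [h' hh'] := niH h; apply/(@nbhdsP (direct_product G H)); exists (b, h').
    rewrite !in_setU !in_setX !in_setC.
    rewrite (subsetP (sub_closure_set _) _ bB) orbC /=.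
    by case: (boolP (h' \in A)) => // h'A;
      have /negP[] := independentP _ indA _ _ hA h'A.
  by rewrite /= /dprod_edge /= bg edge_sym.
(* Off [A]: some neighbour [g'] of [g] escapes [nbhds B], and [h] has a neighbour in [A]. *)
rewrite inE => /subsetPn[g' gg' g'B].
have := subsetP domA h (in_setT h); rewrite inE (negPf hA) => /nbhdsP[a aA ah].
apply/(@nbhdsP (direct_product G H)); exists (g', a).
  by rewrite !in_setU !in_setX !in_setC g'B aA.
by rewrite /= /dprod_edge /= ah edge_sym; move: gg'; rewrite inE => ->.
Qed.

Lemma twisted0 : #|twisted set0| = #|G| * #|A|.
Proof.
have n0 : nbhds set0 = set0 :> {set G}.
  by apply/setP => v; rewrite [RHS]inE; apply/nbhdsP => -[u]; rewrite inE.
rewrite card_twisted n0 cards0 subn0.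
suff -> : closure_set (set0 : {set G}) = set0 by rewrite cards0 addn0.
apply/setP => z; rewrite [RHS]inE; apply/closure_setP => zP.
by have [v /zP] := niG z; rewrite n0 inE.
Qed.

Hypothesis wcGH : well_covered (direct_product G H).

Lemma card_nbhds_closure_set (B : {set G}) : independent B ->
  #|A| * #|nbhds B| = (#|H| - #|A|) * #|closure_set B|.
Proof.
move=> indB.
have := wcGH (maxset_twisted indB) (maxset_twisted (independent_set0 G)).
rewrite twisted0 card_twisted => E.
(* This bound makes the truncated difference [#|G| - #|nbhds B|] exact. *)
have le : #|nbhds B| <= #|G| by apply: max_card.
have : #|A| * #|nbhds B| <= #|G| * #|A| by rewrite mulnC leq_mul2r le orbT.
move: E; rewrite mulnBl (mulnC #|closure_set B|) (mulnC #|nbhds B|).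
lia.
Qed.

(** By well-coveredness the independence number is the size of [twisted set0], which is half of
    [#|G| * #|H|]. *)
Lemma half_very_well_covered :
  2 * #|A| = #|H| -> very_well_covered (direct_product G H).
Proof.
move=> halfA; split=> // [[g h]|].
  have [g' gg'] := niG g; have [h' hh'] := niH h.
  by exists (g', h'); rewrite /= /dprod_edge /= gg'.
rewrite (well_covered_independence_number wcGH
           (maxset_twisted (independent_set0 G))).
by rewrite twisted0 card_prod -halfA mulnCA.
Qed.

End WellCoveredProduct.

(** * The sets [B] and [B :|: X]; exchanging [x] and [y] gives [B :|: Y] *)

Section TriangleFreeEdge.
Variables (G : sgraph) (x y : G).
Hypothesis xy : edge x y.
Hypothesis ind_x : independent (nbhd x).
Variable B : {set G}.
Hypothesis indB : independent B.
Hypothesis BW : B \subset ~: (nbhd x :|: nbhd y).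
Hypothesis domB : ~: (nbhd x :|: nbhd y) \subset B :|: nbhds B.

Let X := nbhd x :\: nbhds B.
Let Y := nbhd y :\: nbhds B.

Lemma free_edge_cover v :
  [|| v \in B, v \in nbhds B, v \in X | v \in Y].
Proof.
have := subsetP domB v; rewrite !in_setU !in_setC !in_setU !in_setD.
case: (v \in B) => //=; case: (v \in nbhds B) => //=.
by case: (v \in nbhd x) => //=; case: (v \in nbhd y) => //= /(_ isT).
Qed.

Lemma free_edge_avoids v : v \in B -> (v \notin nbhd x) && (v \notin nbhd y).
Proof. by move=> /(subsetP BW); rewrite in_setC in_setU negb_or. Qed.

Lemma free_edge_ends v : v \in [set x; y] -> v \notin nbhds B.
Proof.
move=> vxy; apply/nbhdsP => -[b bB bv]; have := free_edge_avoids bB.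
by case/set2P: vxy bv => ->; rewrite !inE edge_sym => ->; rewrite ?andbF.
Qed.

Lemma free_edge_endpoint : y \in X.
Proof. by rewrite in_setD free_edge_ends ?set22 // inE. Qed.

(** A vertex of [X] or [Y] is adjacent to [x] or [y], neither of which is in [nbhds B]. *)
Lemma free_edge_closure_set : closure_set B = B.
Proof.
apply/eqP; rewrite eqEsubset sub_closure_set andbT; apply/subsetP => z zC.
have zNB := closure_set_nbhds indB zC; have /closure_setP zP := zC.
have := free_edge_cover z; rewrite (negPf zNB) !in_setD zNB /=.
by case/or3P=> //; rewrite inE edge_sym => /zP;
   rewrite (negPf (free_edge_ends _)) ?set21 ?set22.
Qed.

Lemma free_edge_independent : independent (B :|: X).
Proof.
apply/independentP => u v.
rewrite !in_setU !in_setD => /orP[uB|/andP[uNB ux]] /orP[vB|/andP[vNB vx]].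
- by have /independentP := indB; apply.
- by apply: contra vNB => uv; apply/nbhdsP; exists u.
- by apply: contra uNB => uv; apply/nbhdsP; exists v; rewrite // edge_sym.
- by have /independentP := ind_x; apply.
Qed.

(** All of [Y] is adjacent to [y], which lies in [X]. Conversely an independent set misses its
    neighbourhood, so the cover leaves only [nbhds B] and [Y]. *)
Lemma free_edge_nbhds : nbhds (B :|: X) = nbhds B :|: Y.
Proof.
apply/setP => v; rewrite in_setU.
case: (boolP (v \in nbhds B)) => vNB /=.
  by apply: (subsetP (nbhdsS (subsetUl _ _))).
rewrite in_setD vNB /=.
apply/idP/idP => [vN|vy].
  have : v \notin B :|: X.
    by apply: contraL vN; apply: independent_nbhds free_edge_independent.
  rewrite in_setU negb_or => /andP[/negPf vB /negPf vX].
  have := free_edge_cover v; rewrite vB (negPf vNB) vX /=.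
  by rewrite in_setD => /andP[].
apply/nbhdsP; exists y; last by rewrite inE in vy.
by rewrite in_setU free_edge_endpoint orbT.
Qed.

(** The closure misses the neighbourhood [nbhds B :|: Y]; the cover leaves [B] and [X]. *)
Lemma free_edge_closure_setU : closure_set (B :|: X) = B :|: X.
Proof.
apply/eqP; rewrite eqEsubset sub_closure_set andbT.
apply/subsetP => z zC.
have zN := closure_set_nbhds free_edge_independent zC.
have := free_edge_cover z; move: zN; rewrite free_edge_nbhds !in_setU negb_or.
by case/andP=> /negPf-> /negPf->; rewrite orbF.
Qed.

Lemma free_edge_card :
  #|closure_set (B :|: X)| = #|closure_set B| + #|X| /\
  #|nbhds (B :|: X)| = #|nbhds B| + #|Y|.
Proof.
rewrite free_edge_closure_setU free_edge_closure_set free_edge_nbhds.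
split; rewrite cardsU [X in _ - X](_ : _ = 0) ?subn0 //.
  apply/eqP; rewrite cards_eq0; apply/eqP/setP => v; rewrite !in_setI in_setD.
  rewrite in_set0; apply/andP => -[/free_edge_avoids/andP[/negPf->]].
  by rewrite andbF.
apply/eqP; rewrite cards_eq0; apply/eqP/setP => v; rewrite !in_setI in_setD.
by rewrite in_set0; case: (v \in nbhds B).
Qed.

End TriangleFreeEdge.

(** * Case split on triangles and the final count *)

Lemma on_triangle_dec (G : sgraph) (x : G) : decidable (on_triangle x).
Proof.
apply: (@decP _ [exists y, exists z, [&& edge x y, edge y z & edge z x]]).
apply: (iffP existsP) => [[y /existsP[z /and3P[]]]|[y [z [xy yz zx]]]].
  by exists y, z.
by exists y; apply/existsP; exists z; rewrite xy yz.
Qed.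

Theorem theorem5p2 (G H : sgraph)
  (ntG : nontrivial G) (ntH : nontrivial H)
  (connG : connected G) (connH : connected H)
  (wcGH : well_covered (direct_product G H))
  (nvwcGH : ~ very_well_covered (direct_product G H)) :
  forall x y : G, edge x y -> on_triangle x \/ on_triangle y.
Proof.
move=> x y xy.
case: (on_triangle_dec x) => [|/triangle_free_nbhd ind_x]; first by left.
case: (on_triangle_dec y) => [|/triangle_free_nbhd ind_y]; first by right.
case: nvwcGH.
have niG := connected_no_isolated_vertex ntG connG.
have niH := connected_no_isolated_vertex ntH connH.
have [A [indA _] domA] := maximal_independent_in [set: H].
apply: (half_very_well_covered niG niH indA domA) => //.
have ratio := card_nbhds_closure_set niG niH indA domA wcGH.
have [B [indB BW] domB] := maximal_independent_in (~: (nbhd x :|: nbhd y)).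
have BW' := BW; have domB' := domB; rewrite setUC in BW' domB'.
have yx : edge y x by rewrite edge_sym.
have [cX nX] := free_edge_card xy ind_x indB BW domB.
have [cY nY] := free_edge_card yx ind_y indB BW' domB'.
have X_gt0 : 0 < #|nbhd x :\: nbhds B|.
  by apply/card_gt0P; exists y; apply: free_edge_endpoint.
have eB := ratio _ indB.
have eX := ratio _ (free_edge_independent ind_x indB).
have eY := ratio _ (free_edge_independent ind_y indB).
rewrite cX nX !mulnDr eB in eX; rewrite cY nY !mulnDr eB in eY.
have leA : #|A| <= #|H| by apply: max_card.
move: eX eY => /addnI eX /addnI eY.
(* Adding the two equations gives both sides the factor |X| + |Y|, positive since [y] is in [X];
   cancelling it leaves |A| = |H| - |A|. *)
have : #|A| * (#|nbhd x :\: nbhds B| + #|nbhd y :\: nbhds B|) =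
       (#|H| - #|A|) * (#|nbhd x :\: nbhds B| + #|nbhd y :\: nbhds B|).
  by rewrite !mulnDr eX eY addnC.
move/eqP; rewrite eqn_pmul2r; last by rewrite addn_gt0 X_gt0.
move/eqP; move: #|A| #|H| leA; clear; lia.
Qed.
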